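(* For any Tychonoff space $X$, $$C_{p}(X)\leqslant C_{k}(X)\leqslant C_{c}(X)\leqslant C_{cc}(X)\leqslant C_{ps}(X)\leqslant C_{rc}(X)\leqslant C_{u}(X)$$ and $$C_{k}(X)\leqslant C_{sc}(X)\leqslant C_{cc}(X).$$
   Context: For two topological spaces $Y,Z$ with the same underlying set, $Y\leqslant Z$ means that the topology of $Z$ is finer than or equal to the topology of $Y$. $C(X)$ is the set of all continuous real-valued functions on $X$. For a family $\lambda$ of non-empty subsets of $X$, the $\lambda$-open topology on $C(X)$ has as subbase all sets $[F,U]=\{f\in C(X): f(F)\subseteq U\}$ with $F\in\lambda$, $U\subseteq\mathbb{R}$ open. A subset $A\subseteq X$ is a $C$-compact subset of $X$ if $f(A)$ is compact in $\mathbb{R}$ for every $f\in C(X)$. $C_p(X)$, $C_k(X)$, $C_c(X)$, $C_{sc}(X)$, $C_{cc}(X)$, $C_{ps}(X)$, $C_{rc}(X)$ denote $C(X)$ with the $\lambda$-open topology where $\lambda$ is the collection of all non-empty subsets of $X$ that are, respectively: finite; metrizable compact; compact; sequentially compact; countably compact; pseudocompact; $C$-compact in $X$. $C_u(X)$ denotes $C(X)$ with the topology of uniform convergence on $X$, having basic neighborhoods $\{g\in C(X):\sup_{x\in X}|g(x)-f(x)|<\varepsilon\}$, $\varepsilon>0$, of $f\in C(X)$. *)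

(* Defs.v *)
From HB Require Import structures.
From mathcomp Require Import all_boot all_order all_algebra.
From mathcomp Require Import all_classical all_reals all_analysis.

Set Implicit Arguments.
Unset Strict Implicit.
Unset Printing Implicit Defensive.

Import Order.TTheory GRing.Theory Num.Theory.
Import numFieldNormedType.Exports.

Local Open Scope classical_set_scope.
Local Open Scope ring_scope.

(* The library phrases complete regularity with uniformities; its equivalence
   with separation by continuous functions into [0, 1] is [uniform_separatorP]. *)
Definition tychonoff_space (X : topologicalType) :=
  accessible_space X /\ completely_regular_space X.

(* The topology Z is finer than or equal to the topology Y. *)
Definition topology_le (T : Type) (Y Z : Topological T) :=
  @open (Topological.Pack Y) `<=` @open (Topological.Pack Z).

Notation "Y <=top Z" := (topology_le Y Z) (at level 70).

Section subsets.
Context (R : realType) (X : topologicalType).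
Implicit Types A : set X.

Definition metrizable (T : topologicalType) :=
  exists m : Metric R T, @open (Metric.Pack m) = @open T.

Definition metrizable_compact A := metrizable (set_type A) /\ compact A.

Definition sequentially_compact A :=
  forall u : nat -> X, (forall n, A (u n)) ->
  exists (s : nat -> nat) (l : X),
    [/\ {homo s : m n / (m < n)%N}, A l & u \o s @ \oo --> l].

Definition countably_compact A :=
  forall U : nat -> set X, (forall n, open (U n)) -> A `<=` \bigcup_n U n ->
  finite_subset_cover setT U A.

Definition pseudocompact A :=
  forall f : set_type A -> R, continuous f -> bounded_set (range f).

Definition C_compact A := forall f : X -> R, continuous f -> compact (f @` A).

Definition nonempty_sets (P : set X -> Prop) : set (set X) :=
  [set A | A !=set0 /\ P A].

End subsets.

Definition lambda_open (R : realType) (X : topologicalType)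
  (lambda : set (set X)) : Type := continuousType X R.

Section lambda_open.
Context (R : realType) (X : topologicalType) (lambda : set (set X)).

HB.instance Definition _ := Choice.on (lambda_open R lambda).

HB.instance Definition _ := isSubBaseTopological.Build (lambda_open R lambda)
  [set FU : set X * set R | lambda FU.1 /\ open FU.2]
  (fun FU => [set f : continuousType X R | f @` FU.1 `<=` FU.2]).

Lemma open_lambda_openE : @open (lambda_open R lambda) =
  [set \bigcup_(V in B) V | B in subset^~ (finI_from
    [set FU : set X * set R | lambda FU.1 /\ open FU.2]
    (fun FU => [set f : continuousType X R | f @` FU.1 `<=` FU.2]))].
Proof. by []. Qed.

End lambda_open.

Section function_spaces.
Context (R : realType) (X : topologicalType).

Definition C_p : Topological (continuousType X R) :=
  Topological.class (lambda_open R (nonempty_sets (@finite_set X))).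
Definition C_k : Topological (continuousType X R) :=
  Topological.class (lambda_open R (nonempty_sets (@metrizable_compact R X))).
Definition C_c : Topological (continuousType X R) :=
  Topological.class (lambda_open R (nonempty_sets (@compact X))).
Definition C_sc : Topological (continuousType X R) :=
  Topological.class (lambda_open R (nonempty_sets (@sequentially_compact X))).
Definition C_cc : Topological (continuousType X R) :=
  Topological.class (lambda_open R (nonempty_sets (@countably_compact X))).
Definition C_ps : Topological (continuousType X R) :=
  Topological.class (lambda_open R (nonempty_sets (@pseudocompact R X))).
Definition C_rc : Topological (continuousType X R) :=
  Topological.class (lambda_open R (nonempty_sets (@C_compact R X))).

Definition C_u : Topological (continuousType X R) :=
  Topological.class (initial_topology
    (fun f : continuousType X R => (f : X -> R) : arrow_uniform_type X R)).

(* The supremum is taken in \bar R because the real-valued [sup] of an unbounded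
   set is 0 by convention. *)
Lemma nbhs_C_uE (f : continuousType X R) :
  @nbhs _ (Topological.Pack C_u) f = filter_from [set e : R | 0 < e]
    (fun e => [set g : continuousType X R |
      (ereal_sup (range (fun x => `|g x - f x|%:E)) < e%:E)%E]).
Proof.
pose M : pseudoMetricType R := initial_topology
  (fun f : continuousType X R => (f : X -> R) : arrow_uniform_type X R).
have ballM (g : M) e : ball (f : M) e g = forall x,
    `|f x - (g : continuousType X R) x| < e by [].
rewrite -(@nbhs_ballE R M); apply/seteqP; split => A [e /= e0 eA].
- exists e => //= g fge; apply: eA; rewrite ballM => x.
  rewrite distrC -lte_fin; apply: le_lt_trans fge.
  by apply: ereal_sup_ubound; exists x.
- exists (e / 2) => /= [|g]; first by rewrite divr_gt0.
  rewrite ballM => fge; apply: eA => /=.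
  apply: (@le_lt_trans _ _ (e / 2)%:E); last first.
    by rewrite lte_fin ltr_pdivrMr// mulr_natr mulr2n ltrDl.
  apply: ge_ereal_sup => _ [x _ <-]; rewrite lee_fin ltW// distrC.
  exact: fge.
Qed.

End function_spaces.

(* Main.v *)
From HB Require Import structures.
Require Import Defs.
From mathcomp Require Import all_boot all_order all_algebra.
From mathcomp Require Import finmap all_classical all_reals all_analysis.

(** All the comparisons that do not involve uniform convergence are between two
lambda-open topologies, and enlarging lambda only enlarges the subbase of sets
[F, U]; so each of them reduces to an implication between compactness
properties of a subset A of X.

- Finite sets are metrizable: in a T1 space all subsets of a finite set are
  closed, so a finite subspace is discrete and the 0-1 distance induces its
  topology ([finite_metrizable_compact]).
- The compact and the sequentially compact sets share one property: every
  sequence in A clusters at a point of A. That property alone yields countable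
  compactness ([cluster_countably_compact]): were no finite subfamily of the
  cover (U_n) enough, a sequence of points u_n of A outside U_0, ..., U_(n-1)
  would exist, it would cluster at a point of some U_m, and yet it leaves U_m
  for good after rank m.
- In a metrizable compact set a cluster point of a sequence has a countable
  shrinking base of neighborhoods, along which a convergent subsequence is
  extracted ([metrizable_compact_sequentially]).
- A continuous function f on a countably compact set is bounded, since the
  preimages of the intervals ]-n, n[ cover the set
  ([countably_compact_pseudocompact]).
- If A is pseudocompact, then f(A) is bounded; it is also closed, for if y were
  an adherent point of f(A) outside f(A), then 1 / (f - y) would be continuous
  and unbounded on A ([pseudocompact_C_compact]).

The comparison with uniform convergence rests on the fact that a compact f(F)
contained in an open set U stays at a positive distance from the complement of
U: any g uniformly closer to f than this distance is still in [F, U]. *)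

Set Implicit Arguments.
Unset Strict Implicit.
Unset Printing Implicit Defensive.

Import Order.TTheory GRing.Theory Num.Theory.
Import numFieldNormedType.Exports.

Local Open Scope classical_set_scope.
Local Open Scope ring_scope.

(** * Comparing lambda-open topologies *)

Section lambda_open_comparison.
Context (R : realType) (X : topologicalType).

(** Opens of a lambda-open topology are unions of finite intersections of
subbasic sets, so openness in Z need only be checked on the latter. *)
Lemma lambda_open_le (lambda : set (set X))
    (Z : Topological (continuousType X R)) :
  (forall F U, lambda F -> open U ->
     @open (Topological.Pack Z) [set f : continuousType X R | f @` F `<=` U]) ->
  topology_le (T := continuousType X R)
    (Topological.class (lambda_open R lambda)) Z.
Proof.
move=> subbase_open O.
rewrite [X in X O -> _]open_lambda_openE => -[B BI <-].
apply: (@bigcup_open (Topological.Pack Z)) => V /BI[D Dsub <-].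
rewrite openE => f fD; apply: filter_bigI => -[F U] FUD.
have /set_mem[/= lF oU] := Dsub _ FUD.
by apply: open_nbhs_nbhs; split; [exact: subbase_open|exact: fD FUD].
Qed.

Lemma lambda_open_mono (lambda mu : set (set X)) : lambda `<=` mu ->
  topology_le (T := continuousType X R)
    (Topological.class (lambda_open R lambda))
    (Topological.class (lambda_open R mu)).
Proof.
move=> sub; apply: lambda_open_le => F U lF oU.
rewrite [X in X _]open_lambda_openE.
exists [set [set f : continuousType X R | f @` F `<=` U]];
  last exact: bigcup_set1.
move=> _ ->.
apply: (@finI_from1 (set X * set R)%type (continuousType X R) _
  (fun FU => [set f : continuousType X R | f @` FU.1 `<=` FU.2]) (F, U)).
by split => //; exact: sub.
Qed.

Lemma nonempty_sets_mono (P Q : set X -> Prop) :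
  (forall A, P A -> Q A) -> nonempty_sets P `<=` nonempty_sets Q.
Proof. by move=> PQ A [A0 /PQ]. Qed.

End lambda_open_comparison.

(** * Finite sets *)

Section finite_metrizable.

(** A fresh name for T, to which the 0-1 distance can be attached without
disturbing a topology already present on T. *)
Definition discrete_metric (R : realType) (T : choiceType) : Type := T.

Context (R : realType) (T : choiceType).
Local Notation M := (discrete_metric R T).

Let dist (x y : M) : R := (x != y :> T)%:R.

Let distxx x : dist x x = 0. Proof. by rewrite /dist eqxx. Qed.

Let dist_eq0 x y : dist x y = 0 -> x = y.
Proof. by rewrite /dist; case: eqP => //= _ /eqP; rewrite oner_eq0. Qed.

Let distC x y : dist x y = dist y x.
Proof. by rewrite /dist eq_sym. Qed.

Let dist_triangle y x z : dist x z <= dist x y + dist y z.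
Proof.
rewrite /dist -natrD ler_nat.
by case: (eqVneq x y) => [->|_] //=; case: (x != z).
Qed.

HB.instance Definition _ := Choice.on M.
HB.instance Definition _ :=
  isMetric.Build R M distxx dist_eq0 distC dist_triangle.

Lemma discrete_metric_open (A : set M) : open A.
Proof.
(* The ball of radius 1 around x is {x}. *)
rewrite openE => x Ax; apply/nbhs_ballP; exists 1 => //= y.
rewrite ballEmdist /= /mdist /= /dist.
by case: (eqVneq (x : T) y) => [<- //|_] /=; rewrite ltxx.
Qed.

End finite_metrizable.

Lemma finite_metrizable_compact (R : realType) (X : topologicalType) :
  accessible_space X ->
  forall A : set X, finite_set A -> metrizable_compact R A.
Proof.
move=> /accessible_finite_set_closed fin_closed A finA.
split; last exact: finite_compact.
exists (Metric.class (discrete_metric R (set_type A))).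
apply/seteqP; split => [B _|B _]; last exact: discrete_metric_open.
(* B is the trace of the complement of the finite, hence closed, set A \ B. *)
exists (~` (set_val @` ~` B)).
  apply: closed_openC; apply: fin_closed; apply: sub_finite_set finA.
  by move=> _ [x _ <-]; exact: set_valP.
apply/seteqP; split => [x /= nx|x Bx /= [y nBy] /val_inj yx].
  by apply: contrapT => nBx; apply: nx; exists x.
by apply: nBy; rewrite yx.
Qed.

(** * Sequences and countable covers *)

Section sequences_and_covers.
Context (X : topologicalType).
Implicit Types A : set X.

(** The common core of [compact_countably_compact] and
[sequentially_countably_compact]: a sequence that avoids U_0, ..., U_(n-1) at
rank n cannot cluster anywhere in the union of the U_n. *)
Lemma cluster_countably_compact A :
  (forall u : nat -> X, (forall n, A (u n)) ->
     exists2 l, A l & cluster (u @ \oo) l) ->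
  countably_compact A.
Proof.
move=> clA U oU AU; apply: contrapT => nofin.
have /choice[u uP] (n : nat) :
    exists x, A x /\ forall i, (i < n)%N -> ~ U i x.
  apply: contrapT => nox; apply: nofin.
  exists [fset i | i in iota 0 n]%fset; first by move=> i _; rewrite inE.
  move=> x Ax; apply: contrapT => nUx; apply: nox; exists x.
  split => // i ltin Ui.
  by apply: nUx; exists i => //=; rewrite !inE/= mem_iota.
have [l /AU[m _ Uml] ul] := clA u (fun n => (uP n).1).
have tail : (u @ \oo) [set u n | n in [set n | (m < n)%N]].
  by exists m.+1 => // n mn; exists n.
have [_ [[n mn <-] Umun]] := ul _ _ tail (open_nbhs_nbhs (conj (oU m) Uml)).
exact: (uP n).2 mn Umun.
Qed.

Lemma compact_countably_compact A : compact A -> countably_compact A.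
Proof.
move=> cA; apply: cluster_countably_compact => u uA.
have [|l [Al ul]] := cA (u @ \oo) _; first by exists 0%N => // n _; exact: uA.
by exists l.
Qed.

Lemma sequentially_countably_compact A :
  sequentially_compact A -> countably_compact A.
Proof.
move=> sA; apply: cluster_countably_compact => u uA.
have [s [l [smono Al us]]] := sA u uA; exists l => //.
move=> B V [N _ NB] /us[N' _ N'V].
have les n : (n <= s n)%N.
  by elim: n => // n /leq_ltn_trans; apply; exact: smono.
exists (u (s (maxn N N'))); split.
- by apply: NB; exact: leq_trans (leq_maxl _ _) (les _).
- by apply: N'V; exact: leq_maxr.
Qed.

(** The indices are chosen recursively, each beyond the previous one and with
its term in the next member of the base. *)
Lemma cluster_subsequence (u : nat -> X) (l : X) (B : nat -> set X) :
  (forall n, nbhs l (B n)) ->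
  (forall V, nbhs l V -> \forall n \near \oo, B n `<=` V) ->
  cluster (u @ \oo) l ->
  exists2 s : nat -> nat, {homo s : m n / (m < n)%N} & u \o s @ \oo --> l.
Proof.
move=> nB Bbase ul.
have /choice[next nextP] (kN : nat * nat) :
    exists n, (kN.2 < n)%N /\ B kN.1 (u n).
  have tail : (u @ \oo) [set u n | n in [set n | (kN.2 < n)%N]].
    by exists kN.2.+1 => // n mn; exists n.
  by have [_ [[n mn <-] Bun]] := ul _ _ tail (nB kN.1); exists n.
(* next (k, N) is an index beyond N whose term lies in B k. *)
pose s := fix s n := if n is k.+1 then next (n, s k) else next (0%N, 0%N).
exists s.
  apply: homo_ltn => [|n]; first exact: ltn_trans.
  by have [] := nextP (n.+1, s n).
move=> V /Bbase; apply: filterS => n; apply.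
by case: n => [|n]; [exact: (nextP (0%N, 0%N)).2|exact: (nextP (n.+1, s n)).2].
Qed.

(** Metrizability only provides a metric with the same open sets; this
transports its balls of radius 1 / (n + 1) to the neighborhoods of the given
topology. *)
Lemma metrizable_nbhs_base (R : realType) (l : X) : metrizable R X ->
  exists2 B : nat -> set X, forall n, nbhs l (B n) &
    forall V, nbhs l V -> \forall n \near \oo, B n `<=` V.
Proof.
case=> m mX; pose M : metricType R := Metric.Pack m; pose l' : M := l.
have nbhsM : @nbhs X X l = @nbhs M M l'.
  by apply/seteqP; split => V; rewrite !nbhsE /open_nbhs -mX.
exists (fun n => @ball R M l' n.+1%:R^-1) => [n|V].
  by rewrite nbhsM; apply: nbhsx_ballx; rewrite invr_gt0 ltr0n.
rewrite nbhsM => /nbhs_ballP[e /= e0 eV].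
have := near_infty_natSinv_lt (PosNum e0); apply: filterS => n /= /ltW ne.
exact: subset_trans (@le_ball R M l' _ _ ne) eV.
Qed.

End sequences_and_covers.

(** Metrizability bears on the type of points of A, compactness on A as a subset
of X: the sequence and its cluster point are moved to the subspace, and the
convergent subsequence is brought back by continuity of the inclusion. *)
Lemma metrizable_compact_sequentially (R : realType) (X : topologicalType)
    (A : set X) :
  metrizable_compact R A -> sequentially_compact A.
Proof.
case=> mA cA u uA.
pose v n : set_type A := SigSub (mem_set (uA n)).
have [|l [Al ul]] := cA (u @ \oo) _; first by exists 0%N => // n _; exact: uA.
pose l' : set_type A := SigSub (mem_set Al).
have vl : cluster (v @ \oo) l'.
  move=> C V [N _ NC] [_ [[W oW <-] Wl WV]].
  have tail : (u @ \oo) [set u n | n in [set n | (N <= n)%N]].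
    by exists N => // n Nn; exists n.
  have [_ [[n Nn <-] Wun]] := ul _ _ tail (open_nbhs_nbhs (conj oW Wl)).
  by exists (v n); split; [exact: NC|exact: WV].
have [B nB Bbase] := metrizable_nbhs_base l' mA.
have [s smono vs] := cluster_subsequence nB Bbase vl.
exists s, l; split => //.
apply: (@cvg_comp _ _ _ (v \o s) (set_val : set_type A -> X) _ _ _ vs).
exact: (@initial_continuous (set_type A) X set_val l').
Qed.

(** * Continuous real-valued functions *)

Section pseudocompactness.
Context (R : realType) (X : topologicalType).
Implicit Types A : set X.

Lemma countably_compact_pseudocompact A :
  countably_compact A -> pseudocompact R A.
Proof.
move=> cA f cf.
(* Opens of the subspace A are traces of opens of X, and countable compactness
   speaks of the latter. *)
have /choice[W WP] (n : nat) : exists W : set X,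
    open W /\ set_val @^-1` W = f @^-1` [set y | `|y| < n%:R].
  suff [W oW Wf] : open (f @^-1` [set y | `|y| < n%:R]) by exists W.
  move/continuousP : cf; apply.
  have -> : [set y : R | `|y| < n%:R] = ball (0 : R) n%:R.
    by apply/seteqP; split => y; rewrite /ball /= sub0r normrN.
  exact: ball_open.
have WE n (x : set_type A) : W n (val x) <-> `|f x| < n%:R.
  by have [_ /seteqP[h1 h2]] := WP n; split; [exact: h1|exact: h2].
have [n|x Ax|D _ DA] := cA W; first exact: (WP n).1.
  pose x' : set_type A := SigSub (mem_set Ax).
  exists (Num.truncn `|f x'|).+1 => //.
  by apply/(WE _ x'); rewrite truncnS_gt.
exists (\max_(i <- D) i)%:R; split=> [|M ltM _ [x _ <-] /=].
  exact: num_real.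
have [n nD /WE fxn] := DA (val x) (set_valP x).
apply/ltW/(le_lt_trans _ ltM)/(le_trans (ltW fxn)).
by rewrite ler_nat; exact: (leq_bigmax_seq (F := id)) nD isT.
Qed.

(** Closedness of f(A) is where pseudocompactness is applied to a function that
need not extend to X: 1 / (f - y) may be undefined outside A. *)
Lemma pseudocompact_C_compact A : pseudocompact R A -> C_compact R A.
Proof.
move=> pA f cf.
have cfA : continuous (fun x : set_type A => f (val x)).
  move=> x; apply: continuous_comp; last exact: cf.
  exact: initial_continuous.
have /pinfty_ex_gt0[M _ bM] := pA _ cfA.
have clfA : closed (f @` A).
  move=> y fAy; apply: contrapT => nfAy.
  have fy (x : set_type A) : f (val x) - y != 0.
    rewrite subr_eq0; apply/eqP => fxy; apply: nfAy.
    by exists (val x) => //; exact: set_valP.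
  have /pA/pinfty_ex_gt0[N N0 bN] :
      continuous (fun x : set_type A => (f (val x) - y)^-1).
    move=> x.
    apply: (@continuousV R (set_type A) (fun x => f (val x) - y) x (fy x)).
    by apply: continuousB; [exact: cfA|exact: cst_continuous].
  have [_ [[x Ax <-]]] : f @` A `&` ball y N^-1 !=set0.
    by apply: fAy; apply: nbhsx_ballx; rewrite invr_gt0.
  rewrite /ball /= distrC => fxy.
  pose x' : set_type A := SigSub (mem_set Ax).
  have := bN _ (imageT _ x'); rewrite /= normfV; apply/negP; rewrite -ltNge.
  by rewrite -(invrK N) ltf_pV2 ?posrE ?invr_gt0// normr_gt0 (fy x').
apply: subclosed_compact clfA (@segment_compact _ (- M) M) _ => _ [x Ax <-].
rewrite /= in_itv/= -ler_norml.
pose x' : set_type A := SigSub (mem_set Ax).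
exact: bM _ (imageT _ x').
Qed.

End pseudocompactness.

(** A uniform version of openness of U along K: around each y of K a margin
holds for all nearby points and all small radii, and the near-covering form of
compactness makes it hold on all of K at once. *)
Lemma compact_ball_margin (R : realType) (K U : set R) :
  compact K -> open U -> K `<=` U ->
  exists2 e : R, 0 < e & forall y, K y -> ball y e `<=` U.
Proof.
move=> /compact_near_coveringP cK oU KU.
have /cK : forall y, K y -> \forall y' \near y & e \near 0^'+, ball y' e `<=` U.
  (* Half of the radius allowed at y is left to the displacement from y
     to y'. *)
  move=> y /KU Uy.
  have /nbhs_ballP[e /= e0 eU] := open_nbhs_nbhs (conj oU Uy).
  have e20 : 0 < e / 2 by rewrite divr_gt0.
  exists (ball y (e / 2), [set d | d <= e / 2]) => /=.
    by split; [exact: nbhsx_ballx|exact: nbhs_right_le].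
  move=> [y' d] /= [yy' de] z y'z; apply: eU.
  rewrite (splitr e); apply: ball_triangle yy' _.
  exact: le_ball y'z.
move=> near_margin.
near (0 : R)^'+ => e.
by exists e => //; near: e; apply: near_margin.
Unshelve. all: by end_near. Qed.

Lemma C_rc_le_C_u (R : realType) (X : topologicalType) :
  topology_le (C_rc R X) (C_u R X).
Proof.
apply: lambda_open_le => F U [_ rcF] oU.
rewrite openE => f fFU; rewrite /interior nbhs_C_uE.
have cfF : compact (f @` F) by apply: rcF; exact: cts_fun.
have [e e0 eU] := compact_ball_margin cfF oU fFU.
exists e => // g /= fge _ [x Fx <-]; apply: (eU (f x)); first by exists x.
rewrite /ball /= distrC -lte_fin; apply: le_lt_trans fge.
by apply: ereal_sup_ubound; exists x.
Qed.

Theorem theorem4p2 (R : realType) (X : topologicalType)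
  (tX : tychonoff_space X) :
  (C_p R X <=top C_k R X /\ C_k R X <=top C_c R X /\ C_c R X <=top C_cc R X /\
   C_cc R X <=top C_ps R X /\ C_ps R X <=top C_rc R X /\
   C_rc R X <=top C_u R X)
  /\ (C_k R X <=top C_sc R X /\ C_sc R X <=top C_cc R X).
Proof.
case: tX => accX _; do !split; last 1 first.
all: first [exact: C_rc_le_C_u|apply/lambda_open_mono/nonempty_sets_mono].
- exact: sequentially_countably_compact.
- exact: finite_metrizable_compact.
- by move=> A [].
- exact: compact_countably_compact.
- exact: countably_compact_pseudocompact.
- exact: pseudocompact_C_compact.
- exact: metrizable_compact_sequentially.
Qed.
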